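(* For the cycle $C_n$ (with $n\ge 3$ vertices), $$SC(C_n)=\begin{cases}n & \text{if } n\le 6,\\ 5 & \text{if } n=7,\\ 6 & \text{if } n\ge 8.\end{cases}$$
   Context: Graphs are finite, simple and undirected, with nonempty vertex set $V(G)$; the order is $n=|V(G)|$. A set $D\subseteq V(G)$ is a strong dominating set of $G$ if for every $x\in V(G)\setminus D$ there is $y\in D$ with $xy\in E(G)$ and $\deg(x)\le\deg(y)$. Two disjoint sets $V_1,V_2\subseteq V(G)$ form a strong coalition if neither is a strong dominating set but $V_1\cup V_2$ is a strong dominating set. A strong coalition partition of $G$ is a partition $\Omega=\{V_1,\dots,V_k\}$ of $V(G)$ into nonempty sets such that each $V_i$ either is a strong dominating set consisting of a single vertex of degree $n-1$, or is not a strong dominating set but forms a strong coalition with another set $V_j\in\Omega$ that is not a strong dominating set. The strong coalition number $SC(G)$ is the maximum cardinality of a strong coalition partition of $G$, with $SC(G)=0$ if $G$ has no strong coalition partition. *)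

(* Defs.v *)
From mathcomp Require Import all_boot.

Set Implicit Arguments.
Unset Strict Implicit.
Unset Printing Implicit Defensive.

Record sgraph := SGraph {
  vertex :> finType;
  adj : rel vertex;
  adj_sym : symmetric adj;
  adj_irrefl : irreflexive adj;
  vertex_gt0 : 0 < #|vertex| }.

Section StrongCoalitions.

Variable G : sgraph.
Implicit Types (x y : G) (D V W : {set G}) (P : {set {set G}}).

Definition deg x : nat := #|[set y | adj x y]|.

Definition strong_dominating D : bool :=
  [forall x, (x \notin D) ==> [exists y in D, adj x y && (deg x <= deg y)]].

Definition strong_coalition V W : bool :=
  [&& [disjoint V & W], ~~ strong_dominating V, ~~ strong_dominating W
    & strong_dominating (V :|: W)].

Definition full_vertex_set V : bool :=
  [exists x, (V == [set x]) && (deg x == #|G|.-1)].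

(* [partition] from finset already requires the blocks to be nonempty. *)
Definition strong_coalition_partition P : bool :=
  partition P [set: G] &&
  [forall V in P,
     (strong_dominating V && full_vertex_set V)
     || (~~ strong_dominating V &&
         [exists W in P :\ V, ~~ strong_dominating W && strong_coalition V W])].

(* The maximum over an empty range is 0, as the convention on graphs without
   a strong coalition partition requires. *)
Definition SC : nat :=
  \max_(P : {set {set G}} | strong_coalition_partition P) #|P|.

End StrongCoalitions.

Definition cycle_adj (n : nat) : rel 'I_n :=
  fun i j => (i.+1 %% n == j) || (j.+1 %% n == i).

Lemma cycle_adj_sym n : symmetric (@cycle_adj n).
Proof. by move=> i j; rewrite /cycle_adj orbC. Qed.

Lemma cycle_adj_irrefl n : 2 < n -> irreflexive (@cycle_adj n).
Proof.
move=> n_gt2 i; rewrite /cycle_adj orbb; apply/negbTE.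
have := ltn_ord i; rewrite leq_eqVlt => /orP[/eqP iE | lt_i].
  by rewrite iE modnn; apply/eqP => i0; rewrite -iE -i0 in n_gt2.
by rewrite modn_small // neq_ltn ltnSn orbT.
Qed.

Lemma cycle_vertex_gt0 n : 2 < n -> 0 < #|'I_n|.
Proof. by rewrite card_ord; case: n. Qed.

Definition cycle_graph (n : nat) (n_ge3 : 3 <= n) : sgraph :=
  SGraph (@cycle_adj_sym n) (cycle_adj_irrefl n_ge3) (cycle_vertex_gt0 n_ge3).

(* Main.v *)
Require Import Defs.
From mathcomp Require Import all_boot.
From mathcomp Require Import zify.

(** Every vertex of a cycle has degree 2, so strong domination in C_n is plain
domination: a set D is strongly dominating exactly when it meets each window
{i, i+1, i+2} of three consecutive vertices ([cycle_dominatingP]).  Moreover,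
for n > 3 no vertex is adjacent to all others, hence every block of a strong
coalition partition is non-dominating and has a coalition partner.

Upper bound 6.  Join two blocks when they form a strong coalition.  If a block
V misses the window at i, then every coalition meets that window, so the at
most three blocks meeting it form a vertex cover of this coalition graph that
avoids V ([coalition_cover]).  A graph without isolated vertices in which every
vertex is avoided by a vertex cover of size at most 3 has at most 6 vertices
([card_le6_of_small_covers]).

For n <= 6 the bound n is the trivial one.  For n = 7 a dominating set has at
least 3 vertices; in a partition into 6 or more blocks any two blocks have at
most 3 vertices together, so some block A has at least two vertices, all other
blocks are singletons, and they must all be partners of A.  But the partners of
A lie in a cover avoiding A, so there are at most 3 of them
([cycle7_partition_le5]).

Lower bounds.  The colour classes of a vertex colouring that passes a finite
test on windows form a strong coalition partition ([coalition_colouring_SC]).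
For n = 4, 5, 6 all vertices get distinct colours, for n = 7 and n = 9 a
colouring is written out, and for the other n >= 8 one uses the word 0 2 3 0 1 4 5 1
followed by a filler in the colours 0 and 1 ([filler_colouring]).  In C_3 every
singleton is a dominating set on a vertex of full degree. *)

Set Implicit Arguments.
Unset Strict Implicit.
Unset Printing Implicit Defensive.

(** * Graphs with small vertex covers avoiding each vertex *)

(** The graph has vertex set P and edges e.  Suppose #|P| > 6 and fix a cover S
of size at most 3: the vertices outside S, at least 4 in number, only have
neighbours in S.  Let N b be the set of vertices outside S adjacent to b.  Any
cover C avoiding b contains N b, and this forces #|N b| <= 2.  By pigeonhole
some b1 in S has #|N b1| = 2, so a cover T1 avoiding b1 has room for only one
more vertex b2.  Every vertex outside S is then in N b1 or N b2, two in each,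
and a cover T2 avoiding b2 must be N b2 together with b1.  A third vertex b3 of
S lies in neither T1 nor T2, so its neighbours lie in both; but T1 and T2 are
disjoint. *)
Lemma card_le6_of_small_covers (T : finType) (P : {set T}) (e : rel T) :
    {in P, forall v, exists2 w, w \in P & e v w} ->
    {in P, forall v, exists C : {set T}, [/\ #|C| <= 3, v \notin C &
       {in P &, forall u w, e u w -> (u \in C) || (w \in C)}]} ->
  #|P| <= 6.
Proof.
move=> e_nbr e_cover; rewrite leqNgt; apply/negP => P_gt6.
have [v0 v0P] : exists v, v \in P by apply/card_gt0P; exact: leq_trans P_gt6.
have [S [S_le3 _ S_cov]] := e_cover v0 v0P.
pose N b := [set v in P :\: S | e v b].
have out_nbr v : v \in P :\: S -> exists2 b, b \in P :&: S & e v b.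
  rewrite inE => /andP[vNS vP]; have [b bP evb] := e_nbr v vP.
  by exists b => //; have := S_cov v b vP bP evb; rewrite (negPf vNS) inE bP.
have out_ge4 : 4 <= #|P :\: S|.
  move: (cardsID S P) (subset_leq_card (subsetIr P S)) S_le3 P_gt6; clear; lia.
have N_cover b (C : {set T}) : b \in P -> b \notin C ->
    {in P &, forall u w, e u w -> (u \in C) || (w \in C)} -> N b \subset C.
  move=> bP bNC C_cov; apply/subsetP => v.
  rewrite !inE => /andP[/andP[_ vP] evb].
  by have := C_cov v b vP bP evb; rewrite (negPf bNC) orbF.
have N_le2 b : b \in P -> #|N b| <= 2.
  move=> bP; rewrite leqNgt; apply/negP => N_gt2.
  have [C [C_le3 bNC C_cov]] := e_cover b bP.
  (* Otherwise N b fills the whole cover C, and C misses any edge from a fourth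
     vertex w outside S. *)
  have NC : N b = C.
    by apply/eqP; rewrite eqEcard N_cover //= (leq_trans C_le3).
  have [w] : exists w, w \in (P :\: S) :\: C.
    apply/card_gt0P; move: (subset_leq_card (subsetIr (P :\: S) C)).
    by move: (cardsID C (P :\: S)) C_le3 out_ge4; clear; lia.
  rewrite inE => /andP[wNC wI]; have [d] := out_nbr w wI.
  rewrite inE => /andP[dP dS] ewd; move: wI; rewrite inE => /andP[_ wP].
  by have := C_cov w d wP dP ewd; rewrite (negPf wNC) /= -NC !inE dS.
have out_N v : v \in P :\: S -> exists2 b, b \in P :&: S & v \in N b.
  move=> vI; have [b bPS evb] := out_nbr v vI.
  by exists b; rewrite // inE vI evb.
have N_notS b v : v \in N b -> v \notin S by rewrite !inE => /andP[/andP[]].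
have [b1 b1PS N1_gt1] : exists2 b, b \in P :&: S & 1 < #|N b|.
  apply/exists_inP; apply: contraLR out_ge4 => /exists_inPn N_le1.
  have out_sub : P :\: S \subset \bigcup_(b in P :&: S) N b.
    by apply/subsetP => v /out_N[b bPS vb]; apply/bigcupP; exists b.
  have cup_le : #|\bigcup_(b in P :&: S) N b| <= \sum_(b in P :&: S) 1.
    elim/big_rec2: _ => [|b m A bPS IH]; first by rewrite cards0.
    apply: leq_trans (leq_card_setU _ _) (leq_add _ IH).
    by rewrite leqNgt N_le1.
  rewrite -ltnNge ltnS (leq_trans (subset_leq_card out_sub)) //.
  rewrite (leq_trans cup_le) // sum1_card.
  exact: leq_trans (subset_leq_card (subsetIr _ _)) S_le3.
have [b1P b1S] := setIP b1PS.
have [T1 [T1_le3 b1T1 T1_cov]] := e_cover b1 b1P.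
have N1T1 := N_cover b1 T1 b1P b1T1 T1_cov.
have S_T1 v b : v \in P -> v \notin T1 -> b \in P -> e v b -> b \in T1.
  by move=> vP vT1 bP evb; have := T1_cov v b vP bP evb; rewrite (negPf vT1).
have [d] : exists d, d \in (P :\: S) :\: T1.
  apply/card_gt0P; move: (subset_leq_card (subsetIr (P :\: S) T1)).
  by move: (cardsID T1 (P :\: S)) T1_le3 out_ge4; clear; lia.
rewrite inE => /andP[dT1 dI]; have [b2 b2PS edb2] := out_nbr d dI.
have [b2P b2S] := setIP b2PS.
have dP : d \in P by case/setDP: dI.
have b2T1 := S_T1 d b2 dP dT1 b2P edb2.
have b2N1 : b2 \notin N b1 by apply: contraL b2S => /N_notS.
have T1E : T1 = b2 |: N b1.
  apply/esym/eqP; rewrite eqEcard subUset sub1set b2T1 N1T1 cardsU1 b2N1.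
  exact: leq_trans T1_le3 (N1_gt1 : 3 <= 1 + #|N b1|).
have out_N12 : P :\: S \subset N b1 :|: N b2.
  apply/subsetP => v vI; rewrite inE; case: (boolP (v \in N b1)) => //= vN1.
  have [vP vS] := setDP vI; have [b bPS evb] := out_nbr v vI.
  have [bP bS] := setIP bPS.
  have vT1 : v \notin T1.
    by rewrite T1E in_setU1 negb_or vN1 andbT; apply: contraNneq vS => ->.
  have := S_T1 v b vP vT1 bP evb; rewrite T1E => /setU1P[<-|/N_notS].
    by rewrite inE vI evb.
  by rewrite bS.
have N12_ge4 := leq_trans out_ge4 (subset_leq_card out_N12).
have N12 := cardsUI (N b1) (N b2).
have N1_le2 := N_le2 b1 b1P; have N2_le2 := N_le2 b2 b2P.
have [T2 [T2_le3 b2T2 T2_cov]] := e_cover b2 b2P.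
have N2T2 := N_cover b2 T2 b2P b2T2 T2_cov.
have [a aN1 aT2] : exists2 a, a \in N b1 & a \notin T2.
  apply/subsetPn; apply/negP => N1T2.
  have N12T2 : N b1 :|: N b2 \subset T2 by rewrite subUset N1T2.
  move: (subset_leq_card N12T2) T2_le3 N12_ge4; clear; lia.
have b1T2 : b1 \in T2.
  move: (aN1); rewrite !inE => /andP[/andP[_ aP] eab1].
  by have := T2_cov a b1 aP b1P eab1; rewrite (negPf aT2).
have b1N2 : b1 \notin N b2 by apply: contraL b1S => /N_notS.
have T2E : T2 = b1 |: N b2.
  apply/esym/eqP; rewrite eqEcard subUset sub1set b1T2 N2T2 cardsU1 b1N2 /=.
  by move: N12 N12_ge4 N1_le2 T2_le3; clear; lia.
(* There are exactly four vertices outside S, hence three in S. *)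
have [b3] : exists b, b \in (P :&: S) :\: [set b1; b2].
  apply/card_gt0P; move: (subset_leq_card (subsetIr (P :&: S) [set b1; b2])).
  have : #|[set b1; b2]| <= 2 by rewrite cards2; case: eqP.
  move: (cardsID [set b1; b2] (P :&: S)) (cardsID S P) P_gt6.
  by move: (subset_leq_card out_N12) N12 N1_le2 N2_le2; clear; lia.
rewrite 2!inE negb_or !inE => /andP[/andP[b31 b32] /andP[b3P b3S]].
have b3N b : b3 \notin N b by apply: contraL b3S => /N_notS.
have [z zP e3z] := e_nbr b3 b3P.
have := T1_cov b3 z b3P zP e3z; have := T2_cov b3 z b3P zP e3z.
rewrite T1E T2E !in_setU1 (negPf b31) (negPf b32) !(negPf (b3N _)) /=.
case/orP=> [/eqP-> | zN2].
  by move: b1T1; rewrite T1E in_setU1 => /negPf->.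
case/orP=> [/eqP zb2 | zN1].
  by rewrite -zb2 T2E in_setU1 zN2 orbT in b2T2.
have zN12 : z \in N b1 :&: N b2 by rewrite inE zN1.
have : 0 < #|N b1 :&: N b2| by apply/card_gt0P; exists z.
by move: N12 N12_ge4 N1_le2 N2_le2; clear; lia.
Qed.

(** * Sizes of the blocks of a partition *)

Lemma partition_card_gt0 (T : finType) (P : {set {set T}}) (D V : {set T}) :
  partition P D -> V \in P -> 0 < #|V|.
Proof.
by case/and3P => _ _ P0 VP; rewrite card_gt0; apply: contraNneq P0 => <-.
Qed.

Lemma card_partition_le (T : finType) (P : {set {set T}}) (D : {set T}) :
  partition P D -> #|P| <= #|D|.
Proof.
move=> partP; rewrite (card_partition partP) -sum1_card.
by apply: leq_sum => V; apply: partition_card_gt0 partP.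
Qed.

Lemma card_partition_pair_le (T : finType) (P : {set {set T}})
    (D V W : {set T}) :
    partition P D -> V \in P -> W \in P -> V != W ->
  #|V| + #|W| + #|P| <= #|D|.+2.
Proof.
move=> partP VP WP VW; have WPV : W \in P :\ V by rewrite in_setD1 eq_sym VW.
rewrite (card_partition partP) (big_setD1 V) //= (big_setD1 W) //=.
rewrite (cardsD1 V P) VP (cardsD1 W (P :\ V)) WPV !add1n !addnS !ltnS addnA.
rewrite leq_add2l -sum1_card; apply: leq_sum => U; rewrite !in_setD1.
by case/and3P => _ _; apply: partition_card_gt0 partP.
Qed.

(** * Domination in a cycle *)

Lemma modnS_lt n i : i < n -> i.+1 %% n = if i.+1 == n then 0 else i.+1.
Proof.
by move=> i_lt; case: eqP => [->|i_neq]; rewrite ?modnn // modn_small //; lia.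
Qed.

Section Cycle.

Variables (n : nat) (n_ge3 : 3 <= n).
Local Notation Cn := (cycle_graph n_ge3).
Implicit Types (i x y : 'I_n) (D V W : {set 'I_n}) (P : {set {set 'I_n}}).

(** The closed neighbourhood of i + 1. *)
Definition window i : {set 'I_n} := [set i; ordS i; ordS (ordS i)].

Lemma card_window_le3 i : #|window i| <= 3.
Proof.
rewrite /window -setUA cardsU1 -[3]/(1 + 2) leq_add ?leq_b1 // cards2.
by rewrite ltnS leq_b1.
Qed.

Lemma ordSS_neq i : ordS (ordS i) != i.
Proof.
apply/eqP => /(congr1 val) /=; rewrite modnS_lt ?ltn_mod; last by lia.
by rewrite modnS_lt //; case: ifP => /eqP; case: ifP => /eqP; lia.
Qed.

Lemma cycle_adjE x y : @adj Cn x y = (ordS x == y) || (ordS y == x).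
Proof. by []. Qed.

Lemma cycle_deg x : deg (x : Cn) = 2.
Proof.
have <- : #|[set ordS x; ord_pred x]| = 2.
  by rewrite cards2 -(inj_eq (@ordS_inj n)) ord_predK ordSS_neq.
apply: eq_card => y; rewrite !inE cycle_adjE eq_sym.
by rewrite (can2_eq (@ordSK n) (@ord_predK n)).
Qed.

Lemma cycle_dominatingP D :
  reflect (forall i, ~~ [disjoint window i & D]) (@strong_dominating Cn D).
Proof.
apply: (iffP forallP) => [dom i | hit x].
  rewrite -setI_eq0; have [iD | iND] := boolP (ordS i \in D).
    by apply/set0Pn; exists (ordS i); rewrite !inE eqxx orbT.
  have /implyP/(_ iND) := dom (ordS i).
  case/exists_inP => y yD; rewrite cycle_adjE => /andP[yi _].
  apply/set0Pn; exists y; rewrite !inE yD andbT.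
  by case/orP: yi => [/eqP-> | /eqP/ordS_inj->]; rewrite eqxx ?orbT.
apply/implyP => xD; have := hit (ord_pred x); rewrite -setI_eq0.
case/set0Pn => y; rewrite !inE ord_predK => /andP[/orP[/orP[]|] /eqP yE yD].
- apply/exists_inP; exists y => //.
  by rewrite cycle_adjE !cycle_deg yE ord_predK eqxx orbT.
- by rewrite -yE yD in xD.
- by apply/exists_inP; exists y => //; rewrite cycle_adjE !cycle_deg yE eqxx.
Qed.

Lemma cycle_dominating_card D : @strong_dominating Cn D -> n <= 3 * #|D|.
Proof.
move/cycle_dominatingP => hit.
have cov : [set: 'I_n] \subset
    D :|: (@ordS n @^-1: D :|: (@ordS n \o @ordS n) @^-1: D).
  apply/subsetP => i _; have := hit i; rewrite -setI_eq0 => /set0Pn[y].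
  by rewrite !inE => /andP[/orP[/orP[]|] /eqP-> ->]; rewrite ?orbT.
have := subset_leq_card cov; rewrite cardsT card_ord => /leq_trans-> //.
rewrite mulSn mulSn mul1n (leq_trans (leq_card_setU _ _)) // leq_add2l.
rewrite (leq_trans (leq_card_setU _ _)) // !card_preimset //.
  exact: inj_comp (@ordS_inj n) (@ordS_inj n).
exact: ordS_inj.
Qed.

(** * Upper bounds for cycles *)

Lemma coalition_cover P (V : {set 'I_n}) :
    partition P [set: 'I_n] -> V \in P -> ~~ @strong_dominating Cn V ->
  exists C : {set {set 'I_n}}, [/\ #|C| <= 3, V \notin C &
    {in P &, forall U W, @strong_coalition Cn U W -> (U \in C) || (W \in C)}].
Proof.
move=> partP VP; case/and3P: (partP) => /eqP covP trivP _ Vndom.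
have [i VI] : exists i, [disjoint window i & V].
  apply/existsP; apply: contraR Vndom => /existsPn hit.
  exact/cycle_dominatingP.
have in_cover y : y \in cover P by rewrite covP inE.
exists (pblock P @: window i); split.
- exact: leq_trans (leq_imset_card _ _) (card_window_le3 i).
- apply/imsetP => -[y yi VE]; move/pred0P/(_ y): VI.
  by rewrite /= yi VE mem_pblock in_cover.
- move=> U W UP WP /and4P[_ _ _ /cycle_dominatingP/(_ i)].
  rewrite -setI_eq0 => /set0Pn[y /setIP[yi /setUP[yU | yW]]]; apply/orP.
    by left; rewrite -(def_pblock trivP UP yU) imset_f.
  by right; rewrite -(def_pblock trivP WP yW) imset_f.
Qed.

Lemma cycle_block_coalition P V : 3 < n ->
    @strong_coalition_partition Cn P -> V \in P ->
  ~~ @strong_dominating Cn V /\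
  exists2 W, W \in P & V != W /\ @strong_coalition Cn V W.
Proof.
move=> n_gt3 /andP[_ /forall_inP Pcoal] VP; case/orP: (Pcoal V VP).
  case/andP=> _ /existsP[x /andP[_]]; rewrite cycle_deg card_ord; lia.
case/andP=> Vndom /exists_inP[W]; rewrite in_setD1 => /andP[WV WP] /andP[_ VW].
by split=> //; exists W => //; rewrite eq_sym.
Qed.

Lemma cycle_partition_le6 P : 3 < n ->
  @strong_coalition_partition Cn P -> #|P| <= 6.
Proof.
move=> n_gt3 coalP; have partP : partition P [set: 'I_n] by case/andP: coalP.
apply: (@card_le6_of_small_covers _ P (@strong_coalition Cn)) => V VP.
  by have [_ [W WP [_ VW]]] := cycle_block_coalition n_gt3 coalP VP; exists W.
have [Vndom _] := cycle_block_coalition n_gt3 coalP VP.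
exact: coalition_cover.
Qed.

Lemma cycle7_partition_le5 P : n = 7 ->
  @strong_coalition_partition Cn P -> #|P| <= 5.
Proof.
move=> n7 coalP; have partP : partition P [set: 'I_n] by case/andP: coalP.
have n_gt3 : 3 < n by rewrite n7.
rewrite leqNgt; apply/negP => P_gt5.
have nbr V : V \in P -> ~~ @strong_dominating Cn V /\
    exists2 W, W \in P &
      [/\ V != W, @strong_coalition Cn V W & 3 <= #|V| + #|W|].
  case/(cycle_block_coalition n_gt3 coalP) => Vndom [W WP [VW coalVW]].
  split=> //; exists W => //; split=> //.
  have /and4P[_ _ _ /cycle_dominating_card VW_card] := coalVW.
  have {VW_card} : n <= 3 * (#|V| + #|W|).
    by apply: leq_trans VW_card _; rewrite leq_mul2l leq_card_setU.
  by move: n7; clear; lia.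
have [A AP A_gt1] : exists2 A, A \in P & 1 < #|A|.
  have [V0 V0P] : exists V, V \in P by apply/card_gt0P; exact: leq_trans P_gt5.
  have [_ [W WP [_ _ VW_ge3]]] := nbr V0 V0P.
  have [?|V0_le1] := ltnP 1 #|V0|; first by exists V0.
  by exists W => //; move: VW_ge3 V0_le1; clear; lia.
have [Andom _] := nbr A AP.
have [C [C_le3 AC C_cov]] := coalition_cover partP AP Andom.
have others_sub : P :\ A \subset C.
  apply/subsetP => U; rewrite in_setD1 => /andP[UA UP].
  have [_ [W WP [UW coalUW UW_ge3]]] := nbr U UP.
  have [WA | WA] := eqVneq W A.
    by have := C_cov _ _ UP WP coalUW; rewrite WA (negPf AC) orbF.
  have le_n2 V : V \in P -> V != A -> #|V| + #|A| + #|P| <= n.+2.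
    move=> VP VA; have := card_partition_pair_le partP VP AP VA.
    by rewrite cardsT card_ord.
  have := le_n2 U UP UA; have := le_n2 W WP WA.
  by move: UW_ge3 P_gt5 A_gt1 n7; clear; lia.
have := leq_trans (subset_leq_card others_sub) C_le3.
by move: P_gt5; rewrite (cardsD1 A P) AP add1n ltnS => /leq_trans H /H.
Qed.

End Cycle.

(** * Lower bounds from colourings *)

(** Some vertex of the window starting at i satisfies q; vertices are natural
numbers below n, so that this computes for closed n. *)
Definition window_meets n (q : pred nat) i :=
  [|| q i, q (i.+1 %% n) | q ((i.+1 %% n).+1 %% n)].

(** Vertex i gets the colour c i < k.  Each colour j < k occurs, its class is not
dominating, and together with the class of the colour p j it is dominating.
That p j differs from j is a consequence. *)
Definition coalition_colouring n k (c p : nat -> nat) : bool :=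
  all (fun i => c i < k) (iota 0 n) &&
  all (fun j =>
    [&& has (fun i => c i == j) (iota 0 n), p j < k,
        ~~ all (window_meets n (fun i => c i == j)) (iota 0 n)
      & all (window_meets n (fun i => (c i == j) || (c i == p j))) (iota 0 n)])
    (iota 0 k).

Section Colouring.

Variables (n : nat) (n_ge3 : 3 <= n).
Local Notation Cn := (cycle_graph n_ge3).

Lemma cycle_dominating_predE (q : pred nat) :
  @strong_dominating Cn [set i : 'I_n | q i] = all (window_meets n q) (iota 0 n).
Proof.
apply/cycle_dominatingP/allP => [hit i | hit i].
  rewrite mem_iota /= => i_lt; have := hit (Ordinal i_lt); rewrite -setI_eq0.
  case/set0Pn => y; rewrite /window_meets !inE => /andP[].
  by case/orP => [/orP[]|] /eqP -> /= ->; rewrite ?orbT.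
have := hit i; rewrite mem_iota ltn_ord => /(_ isT) /or3P qi; rewrite -setI_eq0.
apply/set0Pn; case: qi => qi.
- by exists i; rewrite !inE qi eqxx.
- by exists (ordS i); rewrite !inE qi eqxx orbT.
- by exists (ordS (ordS i)); rewrite !inE qi eqxx orbT.
Qed.

Lemma coalition_colouring_SC k (c p : nat -> nat) :
  coalition_colouring n k c p -> k <= SC Cn.
Proof.
case/andP => /allP c_lt /allP c_coal.
pose B (j : nat) : {set 'I_n} := [set i : 'I_n | c i == j].
have c_ltk (i : 'I_n) : c i < k by apply: c_lt; rewrite mem_iota ltn_ord.
have {}c_coal j : j < k ->
    [/\ B j != set0, p j < k, ~~ @strong_dominating Cn (B j)
      & @strong_dominating Cn (B j :|: B (p j))].
  move=> j_lt; have := c_coal j; rewrite mem_iota j_lt => /(_ isT).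
  case/and4P => /hasP[i]; rewrite mem_iota => i_lt cij pj_lt Bj_ndom Bjp_dom.
  split=> //; first by apply/set0Pn; exists (Ordinal i_lt); rewrite inE.
    by rewrite (cycle_dominating_predE (fun i => c i == j)).
  have -> : B j :|: B (p j) = [set i : 'I_n | (c i == j) || (c i == p j)].
    by apply/setP => x; rewrite !inE.
  by rewrite (cycle_dominating_predE
    (fun i => (c i == j) || (c i == p j))).
have B_inj j1 j2 : j1 < k -> B j1 = B j2 -> j1 = j2.
  case/c_coal => /set0Pn[i iB] _ _ _ B12; move: (iB); rewrite B12.
  by move: iB; rewrite !inE => /eqP-> /eqP.
pose P := [set B (val j) | j in 'I_k].
have BP j (j_lt : j < k) : B j \in P.
  by apply/imsetP; exists (Ordinal j_lt).
have P_card : #|P| = k.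
  rewrite card_imset ?card_ord // => j1 j2 B12.
  exact/val_inj/(B_inj _ _ (ltn_ord j1) B12).
rewrite -P_card /SC; apply: leq_bigmax_cond.
apply/andP; split.
  apply/and3P; split.
  - apply/eqP/setP => i; rewrite inE; apply/bigcupP.
    by exists (B (c i)); rewrite ?BP ?inE.
  - apply/trivIsetP => _ _ /imsetP[j1 _ ->] /imsetP[j2 _ ->].
    apply: contraR => /pred0Pn[i /andP[]].
    by rewrite /= !inE => /eqP <- /eqP <-.
  - apply/imsetP => -[j _ B0]; have [] := c_coal j (ltn_ord j).
    by rewrite -B0 eqxx.
apply/forall_inP => _ /imsetP[j _ ->]; apply/orP; right.
have [_ pj_lt Bj_ndom Bjp_dom] := c_coal j (ltn_ord j).
have [_ _ Bp_ndom _] := c_coal _ pj_lt.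
have pj_neq : B (p j) != B j.
  by apply: contra Bj_ndom => /eqP BB; rewrite -(setUid (B j)) -{2}BB.
rewrite Bj_ndom; apply/exists_inP; exists (B (p j)).
  by rewrite in_setD1 pj_neq BP.
rewrite Bp_ndom; apply/and4P; split=> //; last exact/andP.
apply/pred0P => i; rewrite /= !inE; apply: contraNF pj_neq.
by case/andP => /eqP cj /eqP cp; rewrite -cp cj.
Qed.

End Colouring.

(** In C_3 the blocks are dominating singletons, so the criterion on colourings
does not apply. *)
Lemma SC_cycle3 (n_ge3 : 3 <= 3) : 3 <= SC (cycle_graph n_ge3).
Proof.
pose P : {set {set 'I_3}} := [set [set i] | i in 'I_3].
have P_card : #|P| = 3 by rewrite card_imset ?card_ord //; exact: set1_inj.
rewrite -{1}P_card /SC; apply: leq_bigmax_cond; apply/andP; split.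
  apply/and3P; split.
  - apply/eqP/setP => i; rewrite inE; apply/bigcupP.
    by exists [set i]; rewrite ?inE // imset_f.
  - apply/trivIsetP => _ _ /imsetP[i _ ->] /imsetP[j _ ->] ij.
    by rewrite disjoints1 inE; apply: contraNneq ij => ->.
  - apply/imsetP => -[j _ /setP/(_ j)]; by rewrite !inE eqxx.
apply/forall_inP => _ /imsetP[i _ ->]; apply/orP; left.
apply/andP; split; last first.
  by apply/existsP; exists i; rewrite eqxx cycle_deg card_ord.
have -> : [set i] = [set j : 'I_3 | j == i :> nat].
  by apply/setP => j; rewrite !inE.
rewrite (cycle_dominating_predE _ (fun j => j == i)).
by case: i => [[|[|[|]]]].
Qed.

(** * A colouring with six colours *)

(** The word 0 2 3 0 1 4 5 1, followed by 0 1 0 1 and so on, where the very last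
colour is 1.  Colour 0 is partner of 4 and 5, colour 1 is partner of 2 and 3;
so a window is good if it contains both 0 and 1, or 0, 2 and 3, or 1, 4 and 5.
For n = 9 the filler is a single 1, which creates the bad window 5 1 1. *)
Definition filler_colour n i :=
  if i < 8 then nth 0 [:: 0; 2; 3; 0; 1; 4; 5; 1] i
  else (odd i || (i.+1 == n)) : nat.

Lemma filler_colour_last n i : 8 <= i.+1 -> i.+1 = n -> filler_colour n i = 1.
Proof.
move=> i_ge7 iSn; rewrite /filler_colour iSn eqxx orbT.
by case: ltnP => // i_lt8; rewrite (_ : i = 7) //; lia.
Qed.

Lemma filler_colour_lt8 n i : i < 8 -> filler_colour n i = filler_colour 8 i.
Proof. by rewrite /filler_colour => ->. Qed.

Lemma filler_colour_ge8 n i : 8 <= i -> i.+1 != n -> filler_colour n i = odd i.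
Proof.
by move=> i_ge8 /negPf i_neq; rewrite /filler_colour ltnNge i_ge8 i_neq orbF.
Qed.

Lemma filler_window_early n (q : pred nat) i : 8 <= n -> i < 6 ->
  window_meets n (fun x => q (filler_colour n x)) i =
  [|| q (filler_colour 8 i), q (filler_colour 8 i.+1)
    | q (filler_colour 8 i.+2)].
Proof.
move=> n_ge8 i_lt6; rewrite /window_meets !modn_small; try lia.
by rewrite !(@filler_colour_lt8 n) //; lia.
Qed.

(** From position 6 on, every window contains both colours 0 and 1. *)
Lemma filler_window_late n (q : pred nat) i : 8 <= n -> n != 9 -> 6 <= i < n ->
  q 0 || q 1 -> window_meets n (fun x => q (filler_colour n x)) i.
Proof.
move=> n_ge8 n_neq9 /andP[i_ge6 i_lt] q01; rewrite /window_meets modnS_lt //.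
have [iSn | iSn] := eqVneq i.+1 n.
  rewrite filler_colour_last //; last by lia.
  by case/orP: q01 => ->; rewrite ?orbT.
rewrite /= modnS_lt; last by lia.
have [iSSn | iSSn] /= := eqVneq i.+2 n.
  rewrite [filler_colour n i.+1]filler_colour_last //.
  by case/orP: q01 => ->; rewrite ?orbT.
have [i6 | i_neq6] := eqVneq i 6.
  rewrite i6 (@filler_colour_ge8 n 8) //; last by lia.
  by rewrite !(@filler_colour_lt8 n) //; case/orP: q01 => /= ->; rewrite ?orbT.
have [i7 | i_neq7] := eqVneq i 7.
  rewrite i7 (@filler_colour_ge8 n 8) //; last by lia.
  by rewrite (@filler_colour_lt8 n) //; case/orP: q01 => /= ->; rewrite ?orbT.
rewrite (@filler_colour_ge8 n i) // 1?(@filler_colour_ge8 n i.+1) //=; try lia.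
by case: (odd i); case/orP: q01 => ->; rewrite ?orbT.
Qed.

Lemma filler_colouring n : 8 <= n -> n != 9 ->
  coalition_colouring n 6 (filler_colour n) (nth 0 [:: 4; 2; 1; 1; 0; 0]).
Proof.
move=> n_ge8 n_neq9; apply/andP; split.
  apply/allP => i _; rewrite /filler_colour.
  case: (ltnP i 8) => [|_]; last by case: (_ || _).
  by case: i => [|[|[|[|[|[|[|[|]]]]]]]].
have in_n i : i < 8 -> i \in iota 0 n by rewrite mem_iota; lia.
have in_6 i : i < 6 -> i \in iota 0 6 by rewrite mem_iota.
pose p := nth 0 [:: 4; 2; 1; 1; 0; 0].
pose meets8 (q : pred nat) i :=
  [|| q (filler_colour 8 i), q (filler_colour 8 i.+1)
    | q (filler_colour 8 i.+2)].
(* For each colour: it occurs in the word, its partner is a colour, it misses an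
   early window, the pair meets all early windows and contains 0 or 1. *)
have check : all (fun j => [&& has (fun i => filler_colour 8 i == j) (iota 0 8),
    p j < 6, has (fun i => ~~ meets8 (pred1 j) i) (iota 0 6),
    all (meets8 (pred2 j (p j))) (iota 0 6)
    & pred2 j (p j) 0 || pred2 j (p j) 1]) (iota 0 6) by [].
apply/allP => j /(allP check)/and5P[used pj_lt free /allP early late].
apply/and4P; split=> //.
- have [i] := hasP used; rewrite mem_iota => /= i_lt ij.
  by apply/hasP; exists i; rewrite ?in_n // filler_colour_lt8.
- have [i] := hasP free; rewrite mem_iota => /= i_lt ij.
  apply/allPn; exists i; first by rewrite in_n // (leq_trans i_lt).
  by rewrite (@filler_window_early n (pred1 j)).
- apply/allP => i; rewrite mem_iota => /= i_lt.
  have [i_lt6 | i_ge6] := ltnP i 6.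
    by rewrite (@filler_window_early n (pred2 j (p j))) //; apply/early/in_6.
  by apply: (@filler_window_late n (pred2 j (p j))); rewrite ?i_ge6.
Qed.

Theorem corollary5p6 (n : nat) (n_ge3 : 3 <= n) :
  SC (cycle_graph n_ge3) =
    if n <= 6 then n else if n == 7 then 5 else 6.
Proof.
apply/eqP; rewrite eqn_leq; apply/andP; split.
  apply/bigmax_leqP => P coalP.
  have [n_le6 | n_gt6] := leqP n 6.
    have /andP[partP _] := coalP.
    by have := card_partition_le partP; rewrite cardsT card_ord.
  have [n7 | _] := eqVneq n 7; first exact: cycle7_partition_le5 n7 coalP.
  by apply: cycle_partition_le6 coalP; apply: leq_trans n_gt6.
have [n_le6 | n_gt6] := leqP n 6.
  case: n n_ge3 n_le6 => [|[|[|[|[|[|[|//]]]]]]] // n_ge3 _.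
  - exact: SC_cycle3.
  - by apply: (@coalition_colouring_SC _ _ _ id (fun j => (j + 2) %% 4)).
  - by apply: (@coalition_colouring_SC _ _ _ id (fun j => (j + 2) %% 5)).
  - by apply: (@coalition_colouring_SC _ _ _ id (fun j => (j + 3) %% 6)).
have [n7 | n_neq7] := eqVneq n 7.
  subst n.
  by apply: (@coalition_colouring_SC _ _ _
    (nth 0 [:: 0; 0; 1; 2; 3; 4; 1]) (nth 0 [:: 3; 2; 1; 0; 1])).
have [n9 | n_neq9] := eqVneq n 9.
  subst n.
  by apply: (@coalition_colouring_SC _ _ _
    (fun i => i %% 6) (fun j => (j + 3) %% 6)).
by apply: coalition_colouring_SC (filler_colouring _ n_neq9); lia.
Qed.
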